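(* Let $\phi(t)=\mathbf{E}e^{itY}$ be the characteristic function of the limiting Quicksort random variable $Y$ (which is infinitely differentiable). For each real $p\ge0$ and integer $k\ge0$ there is a constant $c_{p,k}$ such that $|\phi^{(k)}(t)|\le c_{p,k}|t|^{-p}$ for all $t\in\mathbb{R}$.
   Context: Let $g(u):=2u\ln u+2(1-u)\ln(1-u)+1$ for $u\in(0,1)$. The limiting Quicksort random variable $Y$ is the limit in distribution of $(X_n-\mathbf{E}X_n)/n$, where $X_n$ is the number of comparisons used by randomized Quicksort on $n$ distinct numbers; equivalently, its law is the unique law with $\mathbf{E}Y=0$ and finite variance satisfying $Y\overset{d}{=}UY+(1-U)Z+g(U)$, where on the right $U,Y,Z$ are independent, $Z\overset{d}{=}Y$ and $U$ is uniform on $(0,1)$. $Y$ has finite moments of all orders. *)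

(* Defs.v *)
From HB Require Import structures.
From mathcomp Require Import all_boot all_order all_algebra.
From mathcomp Require Import all_classical all_reals all_analysis.
Set Implicit Arguments. Unset Strict Implicit. Unset Printing Implicit Defensive.
Import Order.TTheory GRing.Theory Num.Theory.
Import numFieldNormedType.Exports.
Local Open Scope classical_set_scope.
Local Open Scope ring_scope.

Definition qs_g (R : realType) (u : R) : R :=
  2 * u * ln u + 2 * (1 - u) * ln (1 - u) + 1.

Definition qs_map (R : realType) (v : (R * R) * R) : R :=
  v.1.1 * v.1.2 + (1 - v.1.1) * v.2 + @qs_g R v.1.1.

(* mu is the law of the limiting Quicksort variable Y:
   finite variance, mean zero, and
   Y =d U Y + (1-U) Z + g(U) with U ~ Unif(0,1), Y, Z ~ mu, all independent,
   i.e. mu is the pushforward of Unif(0,1) (x) mu (x) mu under qs_map. *)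
Definition is_quicksort_law (R : realType) (mu : probability R R) : Prop :=
  [/\ mu.-integrable setT (fun x : R => (x ^+ 2)%:E),
      (\int[mu]_x (x%:E) = 0)%E &
      forall A : set R, measurable A ->
        mu A = ((uniform_prob (@ltr01 R) \x mu) \x mu)%E (@qs_map R @^-1` A)].

Definition charfun_re (R : realType) (mu : probability R R) (t : R) : R :=
  fine (\int[mu]_x (cos (t * x))%:E).
Definition charfun_im (R : realType) (mu : probability R R) (t : R) : R :=
  fine (\int[mu]_x (sin (t * x))%:E).

(* Main.v *)
(** The recursion conditioned on the two independent copies [y], [z] writes the
    characteristic function as an average of oscillatory integrals over [u] with
    phase [t (u y + (1 - u) z + g u)]. The second derivative of [g] is at least
    [8], so van der Corput's argument gives [|phi t| <= 5 t^(-1/2)] whatever [y]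
    and [z] are. Conditioning on [u] instead gives
    [|phi t| <= int_0^1 |phi (u t)| |phi ((1 - u) t)| du]; one of the two
    arguments is at least [t / 2] and the other is large except for [u] near [0]
    or [1], so a decay of order [p] improves to order [p + 1/3], and iterating
    reaches every order. The recursion also yields finite moments of all orders,
    because [E U^2 + E (1 - U)^2 = 2/3 < 1]; hence all derivatives of [phi] are
    bounded, and rapid decay passes from the [k]-th derivative to the
    [(k + 1)]-st by Landau's inequality for [f], [f'] and [f'']. *)

Require Import Defs.
From HB Require Import structures.
From mathcomp Require Import all_boot all_order all_algebra.
From mathcomp Require Import all_classical all_reals all_analysis.
From mathcomp Require Import measurable_realfun.
From mathcomp Require Import ring lra.
Import Order.TTheory GRing.Theory Num.Theory.
Import numFieldNormedType.Exports.
Local Open Scope classical_set_scope.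
Local Open Scope ring_scope.

(** * Oscillatory integrals with the recursion phase *)

Section phase.
Context {R : realType}.
Implicit Types (u t th y z w a b l : R).

Definition qs_phase y z u : R := u * y + (1 - u) * z + @qs_g R u.

Definition qs_slope w u : R := w + 2 * (ln u - ln (1 - u)).

Lemma is_derive_ln1m u : u < 1 ->
  is_derive u 1 (fun v : R => ln (1 - v)) (- (1 - u)^-1).
Proof.
move=> u1; have u1' : 0 < 1 - u by lra.
have h1 : is_derive u 1 (fun v : R => 1 - v) (-1).
  by apply: is_derive_eq; rewrite ?/GRing.scale/=; ring.
have := @is_derive1_comp _ (@ln R) (fun v : R => 1 - v) u _ _ (is_derive1_ln u1') h1.
by rewrite mulrN1.
Qed.

Lemma is_derive_qs_phase y z u : 0 < u < 1 ->
  is_derive u 1 (qs_phase y z) (qs_slope (y - z) u).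
Proof.
move=> /andP[u0 u1]; have du := is_derive_ln1m _ u1.
have dl := is_derive1_ln u0.
rewrite /qs_phase /qs_g; apply: is_derive_eq.
rewrite /GRing.scale/= /qs_slope; field; lra.
Qed.

Lemma is_derive_qs_slope w u : 0 < u < 1 ->
  is_derive u 1 (qs_slope w) (2 * (u^-1 + (1 - u)^-1)).
Proof.
move=> /andP[u0 u1]; have du := is_derive_ln1m _ u1.
have dl := is_derive1_ln u0.
rewrite /qs_slope; apply: is_derive_eq.
rewrite /GRing.scale/=; field; lra.
Qed.

Lemma qs_slope_deriv_ge u : 0 < u < 1 -> 8 <= 2 * (u^-1 + (1 - u)^-1).
Proof.
move=> /andP[u0 u1].
have -> : u^-1 + (1 - u)^-1 = (u * (1 - u))^-1 by field; lra.
have h : 0 < u * (1 - u) by apply: mulr_gt0; lra.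
have h4 : u * (1 - u) <= 4^-1 by rewrite -subr_ge0 (_ : _ - _ = (u - 2^-1) ^+ 2) ?sqr_ge0//; field.
have : 4 <= (u * (1 - u))^-1 by rewrite -[leLHS]invrK lef_pV2 ?posrE// invr_gt0; lra.
lra.
Qed.

(** Strict convexity of the phase, through the mean value theorem: at distance [d] from its zero the
    slope is at least [8 * d] in absolute value. *)
Lemma qs_slope_incr w u v : 0 < u -> u <= v -> v < 1 ->
  8 * (v - u) <= qs_slope w v - qs_slope w u.
Proof.
move=> u0 uv v1.
have [||x] := @MVT_segment _ (qs_slope w) (fun x => 2 * (x^-1 + (1 - x)^-1)) u v uv.
- move=> x; rewrite in_itv/= => /andP[ux xv]; apply: is_derive_qs_slope; lra.
- apply: derivable_within_continuous => x; rewrite in_itv/= => /andP[ux xv].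
  by apply: ex_derive; apply: is_derive_qs_slope; lra.
rewrite in_itv/= => /andP[ux xv] ->.
by apply: ler_wpM2r; [lra | apply: qs_slope_deriv_ge; lra].
Qed.

(** The stationary point of the phase: [qs_slope w u = 0] means [ln (u / (1 - u)) = - w / 2]. *)
Definition qs_stat w : R := (1 + expR (w / 2))^-1.

Lemma qs_stat_itv w : 0 < qs_stat w < 1.
Proof.
have h := expR_gt0 (w / 2); rewrite /qs_stat invr_gt0 invf_lt1; lra.
Qed.

Lemma qs_slope_stat w : qs_slope w (qs_stat w) = 0.
Proof.
have h := expR_gt0 (w / 2); rewrite /qs_slope /qs_stat.
have -> : 1 - (1 + expR (w / 2))^-1 = expR (w / 2) * (1 + expR (w / 2))^-1.
  by field; lra.
rewrite lnM ?posrE ?invr_gt0; [|lra..].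
by rewrite expRK; lra.
Qed.

End phase.

(** * The first-derivative test on a stretch where the slope keeps its sign *)

Section van_der_corput.
Context {R : realType}.
Variables (t th y z : R).
Hypothesis t0 : 0 < t.
Let h := qs_phase y z.
Let s := qs_slope (y - z).
Local Notation leb := (@lebesgue_measure R).

(* An antiderivative dominating the oscillating integrand: the correction
   [(1 - sin) h'' / (t h'^2)] is nonnegative because the phase is convex. *)
Let K u := (sin (t * h u + th) - 1) / (t * s u).
Let dK u := cos (t * h u + th) +
  (1 - sin (t * h u + th)) * (2 * (u^-1 + (1 - u)^-1)) / (t * s u ^+ 2).

Let is_derive_K u : 0 < u < 1 -> s u != 0 -> is_derive u 1 K (dK u).
Proof.
move=> u01 su0; have dh := is_derive_qs_phase y z _ u01.
have ds := is_derive_qs_slope (y - z) _ u01.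
have dA : is_derive u 1 (fun v => t * h v + th) (t * s u).
  by apply: is_derive_eq; rewrite /GRing.scale/= addr0.
have dS := @is_derive1_comp _ (@sin R) _ u _ _ (is_derive_sin _) dA.
have dB : is_derive u 1 (fun v => t * s v) (t * (2 * (u^-1 + (1 - u)^-1))).
  by apply: is_derive_eq; rewrite /GRing.scale/=.
have ts0 : t * s u != 0 by rewrite mulf_neq0 // gt_eqF.
have dV := @is_deriveV _ (fun v => t * s v) u _ 1 ts0 dB.
rewrite /K; apply: is_derive_eq.
rewrite /dK /GRing.scale/= /s; move: u01 su0 => /andP[u0 u1] su0.
by field; rewrite su0 !gt_eqF//; lra.
Qed.

Let derivable_osc u : 0 < u < 1 -> derivable (fun v => cos (t * h v + th)) u 1.
Proof.
move=> u01; have dh := is_derive_qs_phase y z _ u01.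
have dA : is_derive u 1 (fun v => t * h v + th) (t * s u).
  by apply: is_derive_eq; rewrite /GRing.scale/= addr0.
have dS := @is_derive1_comp _ (@cos R) _ u _ _ (is_derive_cos _) dA.
exact: ex_derive.
Qed.

Let derivable_dK u : 0 < u < 1 -> s u != 0 -> derivable dK u 1.
Proof.
move=> u01 su0; have dh := is_derive_qs_phase y z _ u01.
have ds := is_derive_qs_slope (y - z) _ u01.
have dA : is_derive u 1 (fun v => t * h v + th) (t * s u).
  by apply: is_derive_eq; rewrite /GRing.scale/= addr0.
have dS := @is_derive1_comp _ (@sin R) _ u _ _ (is_derive_sin _) dA.
have dC := @is_derive1_comp _ (@cos R) _ u _ _ (is_derive_cos _) dA.
have /andP[u0 u1] := u01.
have u0' : u != 0 by lra.
have dI := @is_deriveV _ id u _ 1 u0' (is_derive_id u 1).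
have dJ : is_derive u 1 (fun v : R => (1 - v)^-1) (- ((1 - u) ^- 2) *: (-1)).
  have d1 : is_derive u 1 (fun v : R => 1 - v) (-1).
    by apply: is_derive_eq; rewrite ?/GRing.scale/=; ring.
  by apply: is_deriveV => //; lra.
have dB : is_derive u 1 (fun v => t * s v ^+ 2) (t * (s u *+ 2 * (2 * (u^-1 + (1 - u)^-1)))).
  by apply: is_derive_eq; rewrite ?/GRing.scale/=; ring.
have ts0 : t * s u ^+ 2 != 0 by rewrite mulf_neq0 ?sqrf_eq0 // gt_eqF.
have dV := @is_deriveV _ (fun v => t * s v ^+ 2) u _ 1 ts0 dB.
rewrite /dK; apply: ex_derive.
Qed.

(** The integrand lies below [dK], so its integral is at most [K b - K a], and [K] is at most
    [2 / (t * l)] in absolute value on the segment. *)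
Lemma osc_integral_le a b l : 0 < a -> a <= b -> b < 1 -> 0 < l ->
  (forall u, a <= u <= b -> l <= s u) \/ (forall u, a <= u <= b -> s u <= - l) ->
  \int[leb]_(u in `[a, b]) cos (t * h u + th) <= 2 / (t * l).
Proof.
move=> a0 ab b1 l0 sgn.
have inab u : u \in `[a, b] -> 0 < u < 1 by rewrite in_itv/=; lra.
have s_ne0 u : u \in `[a, b] -> s u != 0.
  rewrite in_itv/= => uab; case: sgn => /(_ u uab); lra.
have ctg : {within `[a, b], continuous (fun u => cos (t * h u + th))}.
  by apply: derivable_within_continuous => u /inab; exact: derivable_osc.
have ctd : {within `[a, b], continuous dK}.
  by apply: derivable_within_continuous => u uab; apply: derivable_dK; [exact: inab|exact: s_ne0].
have KE u : a <= u <= b -> `|K u| <= 2 / (t * l).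
  move=> uab; rewrite /K normf_div; apply: ler_pM => //.
  - have := sin_le1 (t * h u + th); have := sin_geN1 (t * h u + th).
    by rewrite ler_norml; lra.
  - have su : l <= `|s u|.
      by case: sgn => /(_ u uab) su; [rewrite ger0_norm|rewrite ler0_norm]; lra.
    rewrite normrM (gtr0_norm t0) lef_pV2 ?posrE ?mulr_gt0//; last lra.
    by rewrite ler_pM2l.
move: ab; rewrite le_eqVlt => /predU1P[ab|ab].
  by rewrite -ab set_itv1 Rintegral_set1 divr_ge0// ?mulr_ge0// ltW.
have ftc : (\int[leb]_(u in `[a, b]) (dK u)%:E = (K b)%:E - (K a)%:E)%E.
  apply: continuous_FTC2 => //.
  - have cK x : x \in `[a, b] -> {for x, continuous K}.
      move=> xab; apply/differentiable_continuous/derivable1_diffP.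
      by have [] := is_derive_K _ (inab _ xab) (s_ne0 _ xab).
    split.
    + move=> x /subset_itv_oo_cc xab.
      by have [] := is_derive_K _ (inab _ xab) (s_ne0 _ xab).
    + by apply: cvg_at_right_filter; apply: cK; rewrite in_itv/= lexx ltW.
    + by apply: cvg_at_left_filter; apply: cK; rewrite in_itv/= lexx ltW.
  - move=> x /subset_itv_oo_cc xab; rewrite derive1E.
    by have [] := is_derive_K _ (inab _ xab) (s_ne0 _ xab).
apply: (@le_trans _ _ (\int[leb]_(u in `[a, b]) dK u)).
  apply: le_Rintegral => //.
  - by apply: continuous_compact_integrable => //; exact: segment_compact.
  - by apply: continuous_compact_integrable => //; exact: segment_compact.
  - move=> u /= uab; rewrite /dK lerDl; apply: divr_ge0.
    + apply: mulr_ge0; first by rewrite subr_ge0 sin_le1.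
      by have := qs_slope_deriv_ge _ (inab _ uab); lra.
    + by rewrite mulr_ge0 ?sqr_ge0// ltW.
rewrite /Rintegral ftc/=.
have aab : a <= a <= b by rewrite lexx ltW.
have bab : a <= b <= b by rewrite lexx ltW.
have sin1 x : sin x - 1 <= 0 :> R by rewrite subr_le0 sin_le1.
(* [K] has the sign opposite to [s], so one of the two boundary terms is nonpositive and the bound
   [2 / (t * l)] is paid only once. *)
case: sgn => sgn.
- apply: (le_trans _ (KE _ aab)); apply: (@le_trans _ _ (- K a)); last by rewrite -normrN ler_norm.
  rewrite gerDr; apply: mulr_le0_ge0 => //.
  by rewrite invr_ge0 mulr_ge0 ?(ltW t0)// (le_trans (ltW l0))// sgn.
- apply: (le_trans _ (KE _ bab)); apply: (@le_trans _ _ (K b)); last by rewrite ler_norm.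
  rewrite gerDl oppr_le0; apply: mulr_le0 => //.
  rewrite invr_le0 mulr_ge0_le0 ?(ltW t0)//.
  by have := sgn a aab; lra.
Qed.
End van_der_corput.

(** * Integrals of bounded measurable functions over segments *)

Section segment_integral.
Context {R : realType}.
Local Notation leb := (@lebesgue_measure R).
Variable f : R -> R.
Hypothesis mf : measurable_fun setT f.

Lemma bounded_segment_integrable M a b : (forall u, `|f u| <= M) ->
  leb.-integrable `[a, b] (EFin \o f).
Proof.
move=> fM; apply: measurable_bounded_integrable => //.
- by rewrite /= lebesgue_measure_itv/=; case: ifPn => // _; rewrite -EFinB ltry.
- exact: measurable_funTS.
- by exists M; split; [exact: num_real|move=> x Mx u _ /=; rewrite (le_trans (fM u)) ?ltW].
Qed.

Lemma Rintegral_segment_split M a b c : (forall u, `|f u| <= M) -> a <= b -> b <= c ->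
  \int[leb]_(u in `[a, c]) f u =
  \int[leb]_(u in `[a, b]) f u + \int[leb]_(u in `[b, c]) f u.
Proof.
move=> fM ab bc.
have ifc := bounded_segment_integrable _ a c fM.
have := @Rintegral_itvB _ f (BLeft a) (BRight c) b ifc.
rewrite !bnd_simp => /(_ ab bc) E.
rewrite -(@Rintegral_itv_obnd_cbnd _ b (BRight c)); last first.
  apply: integrableS (bounded_segment_integrable _ b c fM) => //.
  exact: subset_itv_oc_cc.
by rewrite -E addrC subrK.
Qed.

Lemma Rintegral_segment_le M N a b : (forall u, `|f u| <= M) -> a <= b ->
  (forall u, a <= u <= b -> `|f u| <= N) ->
  `|\int[leb]_(u in `[a, b]) f u| <= N * (b - a).
Proof.
move=> fM ab fN.
have ifab := bounded_segment_integrable _ a b fM.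
apply: (@le_trans _ _ (\int[leb]_(u in `[a, b]) `|f u|)).
  exact: le_normr_Rintegral.
apply: (@le_trans _ _ (\int[leb]_(u in `[a, b]) N)).
  apply: le_Rintegral => //; first exact: integrable_norm ifab.
  apply: measurable_bounded_integrable => //.
  - by rewrite /= lebesgue_measure_itv/=; case: ifPn => // _; rewrite -EFinB ltry.
  - exact: bounded_cst.
rewrite Rintegral_cst//= lebesgue_measure_itv/= lte_fin.
case: ltP => [_ //|ba]; rewrite /= mulr0 mulr_ge0 ?subr_ge0//.
by rewrite (le_trans _ (fN a _)) ?lexx.
Qed.
End segment_integral.

(** * Decay of the integral over [u], uniformly in [y] and [z] *)

Section quicksort_oscillation.
Context {R : realType}.
Local Notation leb := (@lebesgue_measure R).

Lemma measurable_qs_g : measurable_fun setT (@qs_g R).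
Proof.
have m1 : measurable_fun setT (fun u : R => 1 - u) by apply: measurable_funB.
rewrite /qs_g; apply: measurable_funD => //; apply: measurable_funD.
- apply: measurable_funM => //; exact: measurable_funM.
- by apply: measurable_funM; [exact: measurable_funM|exact: measurableT_comp].
Qed.

Lemma measurable_qs_phase (y z : R) : measurable_fun setT (qs_phase y z).
Proof.
rewrite /qs_phase; apply: measurable_funD; last exact: measurable_qs_g.
by apply: measurable_funD; apply: measurable_funM => //; apply: measurable_funB.
Qed.

(** Cut out a window of length [d] on either side of the stationary point and one at each end of the
    unit interval, where the logarithms blow up; these cost at most [4 * d]. On the two remaining
    stretches the slope is at least [8 * d] in size, so each costs [2 / (t * (8 * d))]. *)
Lemma osc_integral01_le (t th y z d : R) : 0 < t -> 0 < d ->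
  \int[leb]_(u in `[0, 1]) cos (t * qs_phase y z u + th) <=
    4 * d + 1 / (2 * t * d).
Proof.
move=> t0 d0; set f := fun u => cos (t * qs_phase y z u + th).
have mf : measurable_fun setT f.
  apply: measurableT_comp; first exact: continuous_measurable_fun (@continuous_cos R).
  apply: measurable_funD => //; apply: measurable_funM => //.
  exact: measurable_qs_phase.
have f1 u : `|f u| <= 1 by rewrite ler_norml cos_geN1 cos_le1.
have /andP[m0 m1] := qs_stat_itv (y - z); have sm := qs_slope_stat (y - z).
set m := qs_stat _ in m0 m1 sm.
have td0 : 0 < t * d by rewrite mulr_gt0.
have E : 1 / (2 * t * d) = 2 / (t * (8 * d)) + 2 / (t * (8 * d)) by field; lra.
have P : 0 < 2 / (t * (8 * d)) by rewrite divr_gt0// mulr_gt0//; lra.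
have split := Rintegral_segment_split _ mf.
have trivial a b : a <= b -> \int[leb]_(u in `[a, b]) f u <= b - a.
  move=> ab; rewrite (le_trans (ler_norm _))// -[leRHS]mul1r.
  by apply: (Rintegral_segment_le _ mf 1 1 a b) => //.
have left : \int[leb]_(u in `[0, m]) f u <= 2 * d + 2 / (t * (8 * d)).
  (* If [m <= 2 * d], the two windows already cover this side. *)
  have [md|dm] := leP m (2 * d); first by have := trivial 0 m; lra.
  rewrite (split _ 0 d m f1); [|lra..].
  rewrite (split _ d (m - d) m f1); [|lra..].
  have := trivial 0 d; have := trivial (m - d) m.
  suff : \int[leb]_(u in `[d, m - d]) f u <= 2 / (t * (8 * d)) by lra.
  apply: osc_integral_le => //; [lra..|]; right => u /andP[du um].
  by have := qs_slope_incr (y - z) u m; rewrite sm; lra.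
have right : \int[leb]_(u in `[m, 1]) f u <= 2 * d + 2 / (t * (8 * d)).
  have [md|dm] := leP (1 - m) (2 * d); first by have := trivial m 1; lra.
  rewrite (split _ m (m + d) 1 f1); [|lra..].
  rewrite (split _ (m + d) (1 - d) 1 f1); [|lra..].
  have := trivial m (m + d); have := trivial (1 - d) 1.
  suff : \int[leb]_(u in `[(m + d), (1 - d)]) f u <= 2 / (t * (8 * d)) by lra.
  apply: osc_integral_le => //; [lra..|]; left => u /andP[du um].
  by have := qs_slope_incr (y - z) m u; rewrite sm; lra.
rewrite (split _ 0 m 1 f1); lra.
Qed.

Lemma osc_integral01 (t th y z : R) : 0 < t ->
  `|\int[leb]_(u in `[0, 1]) cos (t * qs_phase y z u + th)| <= 5 * t `^ (- (1 / 2)).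
Proof.
(* This [d] makes the two costs comparable: they become [4 * d] and [d / 2]. *)
move=> t0; set d := t `^ (- (1 / 2)).
have d0 : 0 < d by apply: powR_gt0.
have dd : t * d = d^-1.
  rewrite /d -powRN opprK -[X in X * _](powRr1 (ltW t0)) -powRD; last first.
    by rewrite (gt_eqF t0) implybT.
  by congr (_ `^ _); field.
have B : 4 * d + 1 / (2 * t * d) <= 5 * d.
  by rewrite -mulrA dd div1r invfM invrK; lra.
have up th' := le_trans (osc_integral01_le t th' y z d t0 d0) B.
rewrite ler_norml up andbT lerNl.
(* A shift of the free phase [th] by [pi] turns the lower bound into an upper bound. *)
have -> : - (\int[leb]_(u in `[0, 1]) cos (t * qs_phase y z u + th)) =
   \int[leb]_(u in `[0, 1]) cos (t * qs_phase y z u + (th + pi)).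
  rewrite -mulN1r -RintegralZl//.
    by apply: eq_Rintegral => u _; rewrite addrA cosDpi mulN1r.
  apply: (@bounded_segment_integrable _ _ _ 1); last first.
    by move=> u; rewrite ler_norml cos_geN1 cos_le1.
  apply: measurableT_comp; first exact: continuous_measurable_fun (@continuous_cos R).
  apply: measurable_funD => //; apply: measurable_funM => //.
  exact: measurable_qs_phase.
exact: up.
Qed.
End quicksort_oscillation.

(** * The recursion as iterated integrals *)

Section bounded_integrals.
Context {R : realType} {d} {T : measurableType d} (P : probability T R).
Variables (f : T -> R) (M : R).
Hypotheses (mf : measurable_fun setT f) (fM : forall x, `|f x| <= M).

Lemma bounded_prob_integrable : P.-integrable setT (EFin \o f).
Proof.
apply: measurable_bounded_integrable => //.
- by rewrite (le_lt_trans (probability_le1 _ _)) ?ltry.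
- by exists M; split; [exact: num_real|move=> x Mx u _ /=; rewrite (le_trans (fM u)) ?ltW].
Qed.

Lemma le_normr_prob_Rintegral : `|\int[P]_x f x| <= M.
Proof.
apply: (@le_trans _ _ (\int[P]_x `|f x|)).
  by apply: le_normr_Rintegral => //; exact: bounded_prob_integrable.
apply: (@le_trans _ _ (\int[P]_x M)); last first.
  by rewrite Rintegral_cst//= probability_setT mulr1.
apply: le_Rintegral => //.
- exact: integrable_norm bounded_prob_integrable.
- exact: finite_measure_integrable_cst.
Qed.
End bounded_integrals.

(** * Fubini for bounded functions *)

Section bounded_fubini.
Context {R : realType} {d1 d2} {T1 : measurableType d1} {T2 : measurableType d2}.
Variables (P1 : probability T1 R) (P2 : probability T2 R) (f : T1 * T2 -> R) (M : R).
Hypotheses (mf : measurable_fun setT f) (fM : forall x, `|f x| <= M).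

Let intf := bounded_prob_integrable (P1 \x P2)%E f M mf fM.

Lemma bounded_fubini1 :
  \int[(P1 \x P2)%E]_v f v = \int[P1]_x \int[P2]_y f (x, y).
Proof.
rewrite /Rintegral -(integral12_prod_meas1 intf); congr fine.
apply: eq_integral => x _; rewrite fineK//.
apply: integrable_fin_num => //; apply: (bounded_prob_integrable _ _ M) => //.
exact: measurableT_comp mf (pair1_measurable x).
Qed.

Lemma bounded_fubini2 :
  \int[(P1 \x P2)%E]_v f v = \int[P2]_y \int[P1]_x f (x, y).
Proof.
rewrite /Rintegral -(integral21_prod_meas1 intf); congr fine.
apply: eq_integral => y _; rewrite fineK//.
apply: integrable_fin_num => //; apply: (bounded_prob_integrable _ _ M) => //.
exact: measurableT_comp mf (pair2_measurable y).
Qed.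

Lemma measurable_Rintegral_pair1 : measurable_fun setT (fun x => \int[P2]_y f (x, y)).
Proof.
have := measurable_fubini_F intf.
by move=> mF; apply: (measurableT_comp _ mF); exact: fine_measurable.
Qed.

Lemma measurable_Rintegral_pair2 : measurable_fun setT (fun y => \int[P1]_x f (x, y)).
Proof.
have := measurable_fubini_G intf.
by move=> mF; apply: (measurableT_comp _ mF); exact: fine_measurable.
Qed.

End bounded_fubini.

Section uniform01.
Context {R : realType}.
Local Notation leb := (@lebesgue_measure R).
Local Notation U := (uniform_prob (@ltr01 R)).

Lemma integral_uniform01 (f : R -> \bar R) :
  measurable_fun setT f -> (forall x, 0 <= f x)%E ->
  (\int[U]_u f u = \int[leb]_(u in `[0%R, 1%R]) f u)%E.
Proof. by move=> mf f0; rewrite integral_uniform// subr0 invr1 mul1e. Qed.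

Lemma Rintegral_uniform01 (f : R -> R) M : measurable_fun setT f ->
  (forall u, `|f u| <= M) ->
  \int[U]_u f u = \int[leb]_(u in `[0, 1]) f u.
Proof.
move=> mf fM.
(* Adding [M] makes the integrand nonnegative, so that [integral_uniform01] applies; the constant is
   cancelled at the end. *)
have mfM : measurable_fun setT (fun u => f u + M) by exact: measurable_funD.
have E : \int[U]_u (f u + M) = \int[leb]_(u in `[0, 1]) (f u + M).
  rewrite /Rintegral integral_uniform01//; first exact/measurable_EFinP.
  by move=> x; rewrite lee_fin -lerBlDr sub0r; move: (fM x); rewrite ler_norml => /andP[].
have ic : leb.-integrable `[0, 1] (EFin \o cst M).
  by apply: (@bounded_segment_integrable _ _ _ `|M|).
move: E; rewrite RintegralD//; last 2 first.
- exact: (bounded_prob_integrable U f M mf fM).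
- exact: finite_measure_integrable_cst.
rewrite RintegralD//; last exact: bounded_segment_integrable _ mf _ _ _ fM.
rewrite !Rintegral_cst//= lebesgue_measure_itv/= lte_fin ltr01 oppr0 adde0.
by rewrite probability_setT; apply: addIr.
Qed.
End uniform01.

(** * Integrals against the image of a product measure *)

Section pushforward_of_product.
Context {R : realType} {d1 d2 d} {T1 : measurableType d1} {T2 : measurableType d2}
  {T : measurableType d}.
Variables (P1 : probability T1 R) (P2 : probability T2 R).
Variables (mu : probability T R) (phi : T1 * T2 -> T).
Hypothesis mphi : measurable_fun setT phi.
Hypothesis muE : forall A, measurable A -> mu A = (P1 \x P2)%E (phi @^-1` A).

Lemma ge0_integral_pushforward_prod (G : T -> \bar R) : measurable_fun setT G ->
  (forall x, 0 <= G x)%E ->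
  (\int[mu]_x G x = \int[P2]_z \int[P1]_u G (phi (u, z)))%E.
Proof.
move=> mG G0; have mGq := measurableT_comp mG mphi.
transitivity (\int[(P1 \x P2)%E]_v (G (phi v)))%E; last first.
  by rewrite (fubini_tonelli2 _ mGq) => [|v]; last exact: G0.
rewrite (eq_measure_integral (pushforward (P1 \x P2)%E phi)) => //; last first.
  by move=> A mA _; exact: muE.
by rewrite ge0_integral_pushforward// preimage_setT.
Qed.

Lemma measurable_ge0_integral_prod (G : T -> \bar R) : measurable_fun setT G ->
  (forall x, 0 <= G x)%E ->
  measurable_fun setT (fun z => \int[P1]_u G (phi (u, z)))%E.
Proof.
move=> mG G0.
exact: (measurable_fun_fubini_tonelli_G _ (measurableT_comp mG mphi) (fun v => G0 _)).
Qed.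

Lemma Rintegral_pushforward_prod (G : T -> R) (M : R) :
  measurable_fun setT G -> (forall x, `|G x| <= M) ->
  \int[mu]_x G x = \int[P2]_z \int[P1]_u G (phi (u, z)).
Proof.
move=> mG GM; have mGq := measurableT_comp mG mphi.
transitivity (\int[(P1 \x P2)%E]_v (G (phi v))); last first.
  exact: (bounded_fubini2 P1 P2 _ M mGq (fun v => GM _)).
rewrite /Rintegral; congr fine.
rewrite (eq_measure_integral (pushforward (P1 \x P2)%E phi)) => //; last first.
  by move=> A mA _; exact: muE.
rewrite integral_pushforward ?preimage_setT//; first exact/measurable_EFinP.
exact: (bounded_prob_integrable (P1 \x P2)%E (G \o phi) M mGq (fun v => GM _)).
Qed.

Lemma Rintegral_pushforward_prod_le (G : T -> R) (M c : R) :
  measurable_fun setT G -> (forall x, `|G x| <= M) ->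
  (forall z, `|\int[P1]_u G (phi (u, z))| <= c) -> `|\int[mu]_x G x| <= c.
Proof.
move=> mG GM Gc; rewrite (Rintegral_pushforward_prod _ M mG GM).
apply: le_normr_prob_Rintegral => //.
exact: (measurable_Rintegral_pair2 P1 P2 _ M (measurableT_comp mG mphi) (fun v => GM _)).
Qed.
End pushforward_of_product.

Section pushforward_of_triple_product.
Context {R : realType} {d1 d2 d3 d} {T1 : measurableType d1} {T2 : measurableType d2}
  {T3 : measurableType d3} {T : measurableType d}.
Variables (P1 : probability T1 R) (P2 : probability T2 R) (P3 : probability T3 R).
Variables (mu : probability T R) (phi : T1 * T2 * T3 -> T).
Hypothesis mphi : measurable_fun setT phi.
Hypothesis muE : forall A, measurable A ->
  mu A = ((P1 \x P2) \x P3)%E (phi @^-1` A).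

Let mphiz z : measurable_fun setT (fun v : T1 * T2 => phi (v, z)) :=
  measurableT_comp mphi (pair2_measurable z).

Lemma ge0_integral_triple (G : T -> \bar R) : measurable_fun setT G ->
  (forall x, 0 <= G x)%E ->
  (\int[mu]_x G x = \int[P3]_z \int[P1]_u \int[P2]_y G (phi (u, y, z)))%E.
Proof.
move=> mG G0; rewrite (ge0_integral_pushforward_prod _ _ _ _ mphi muE _ mG G0).
apply: eq_integral => z _.
by rewrite (fubini_tonelli1 _ (measurableT_comp mG (mphiz z))) => [//|v]; exact: G0.
Qed.

Lemma measurable_ge0_integral_triple (G : T -> \bar R) : measurable_fun setT G ->
  (forall x, 0 <= G x)%E ->
  measurable_fun setT (fun z => \int[P1]_u \int[P2]_y G (phi (u, y, z)))%E.
Proof.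
move=> mG G0.
have := measurable_ge0_integral_prod (P1 \x P2)%E _ mphi _ mG G0.
congr measurable_fun; apply/funext => z.
by rewrite (fubini_tonelli1 _ (measurableT_comp mG (mphiz z))) => [//|v]; exact: G0.
Qed.

Variables (G : T -> R) (M : R).
Hypotheses (mG : measurable_fun setT G) (GM : forall x, `|G x| <= M).

Let mGz z : measurable_fun setT (fun v => G (phi (v, z))) := measurableT_comp mG (mphiz z).

(** Serves to condition on the last two factors, in which the oscillation estimate over [u] is
    uniform. *)
Lemma Rintegral_triple_le (c : R) :
  (forall z y, `|\int[P1]_u G (phi (u, y, z))| <= c) -> `|\int[mu]_x G x| <= c.
Proof.
move=> Gc; apply: (Rintegral_pushforward_prod_le _ _ _ _ mphi muE _ M c mG GM) => z.
rewrite (bounded_fubini2 _ _ _ M (mGz z))//.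
apply: le_normr_prob_Rintegral => //.
exact: (measurable_Rintegral_pair2 P1 P2 _ M (mGz z) (fun v => GM _)).
Qed.

(** Moving the second factor last makes its integral a function on [T1 * T3], to which Fubini
    applies in either order. *)
Let swap (v : T1 * T3 * T2) : T1 * T2 * T3 := (v.1.1, v.2, v.1.2).

Let mGswap : measurable_fun setT (fun v => G (phi (swap v))).
Proof.
have mswap : measurable_fun setT swap.
  apply: measurable_fun_pair; last exact: measurableT_comp measurable_snd measurable_fst.
  by apply: measurable_fun_pair => //; exact: measurableT_comp measurable_fst measurable_fst.
exact: measurableT_comp mG (measurableT_comp mphi mswap).
Qed.

Let mH := measurable_Rintegral_pair1 (P1 \x P3)%E P2 _ M mGswap (fun v => GM _).

Let HM v : `|\int[P2]_y G (phi (v.1, y, v.2))| <= M.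
Proof.
apply: le_normr_prob_Rintegral => //.
exact: measurableT_comp (mGz v.2) (pair1_measurable v.1).
Qed.

(** Serves to condition on the first factor: with [u] fixed, the two independent copies can be
    separated. *)
Lemma Rintegral_triple_outer1 :
  \int[mu]_x G x = \int[P1]_u \int[P3]_z \int[P2]_y G (phi (u, y, z)).
Proof.
transitivity (\int[P3]_z \int[P1]_u \int[P2]_y G (phi (u, y, z))).
  rewrite (Rintegral_pushforward_prod _ _ _ _ mphi muE _ M mG GM).
  by apply: eq_Rintegral => z _; rewrite (bounded_fubini1 _ _ _ M (mGz z)).
rewrite -(bounded_fubini1 P1 P3 (fun v => \int[P2]_y G (phi (v.1, y, v.2))) M mH)//.
by rewrite (bounded_fubini2 P1 P3 _ M mH).
Qed.

Lemma measurable_Rintegral_triple_outer1 :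
  measurable_fun setT (fun u => \int[P3]_z \int[P2]_y G (phi (u, y, z))).
Proof. exact: (measurable_Rintegral_pair1 P1 P3 _ M mH HM). Qed.

End pushforward_of_triple_product.

(** * The Quicksort recursion under the integral sign *)

Section quicksort_recursion.
Context {R : realType} (mu : probability R R).
Hypothesis qs : is_quicksort_law mu.
Local Notation U := (uniform_prob (@ltr01 R)).
Local Notation leb := (@lebesgue_measure R).

Lemma measurable_qs_map : measurable_fun setT (@qs_map R).
Proof.
have m1 : measurable_fun setT (fun v : R * R * R => v.1.1) by exact: measurableT_comp.
have m2 : measurable_fun setT (fun v : R * R * R => v.1.2) by exact: measurableT_comp.
apply: measurable_funD; last exact: measurableT_comp measurable_qs_g m1.
apply: measurable_funD; first exact: measurable_funM.
by apply: measurable_funM => //; exact: measurable_funB.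
Qed.

Let muE (A : set R) : measurable A ->
  mu A = ((U \x mu) \x mu)%E (@qs_map R @^-1` A).
Proof. by case: qs => _ _; apply. Qed.

Lemma ge0_quicksort_integral (G : R -> \bar R) : measurable_fun setT G ->
  (forall x, 0 <= G x)%E ->
  (\int[mu]_x G x =
   \int[mu]_z \int[U]_u \int[mu]_y G (qs_map (u, y, z)))%E.
Proof.
move=> mG G0.
exact: (@ge0_integral_triple R _ _ _ _ _ _ _ _ U mu mu mu _ measurable_qs_map muE G mG G0).
Qed.

Lemma measurable_ge0_quicksort_integral (G : R -> \bar R) : measurable_fun setT G ->
  (forall x, 0 <= G x)%E ->
  measurable_fun setT (fun z => \int[U]_u \int[mu]_y G (qs_map (u, y, z)))%E.
Proof.
move=> mG G0.
exact: (@measurable_ge0_integral_triple R _ _ _ _ _ _ _ _ U mu _ measurable_qs_map G mG G0).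
Qed.

Variables (G : R -> R) (M : R).
Hypotheses (mG : measurable_fun setT G) (GM : forall x, `|G x| <= M).

Lemma quicksort_Rintegral_le (c : R) :
  (forall z y, `|\int[U]_u G (qs_map (u, y, z))| <= c) -> `|\int[mu]_x G x| <= c.
Proof.
exact: (@Rintegral_triple_le R _ _ _ _ _ _ _ _ U mu mu mu _ measurable_qs_map muE G M mG GM c).
Qed.

Lemma quicksort_Rintegral_outer1 :
  \int[mu]_x G x = \int[U]_u \int[mu]_z \int[mu]_y G (qs_map (u, y, z)).
Proof.
exact: (@Rintegral_triple_outer1 R _ _ _ _ _ _ _ _ U mu mu mu _ measurable_qs_map muE G M mG GM).
Qed.

Lemma measurable_quicksort_outer1 :
  measurable_fun setT (fun u => \int[mu]_z \int[mu]_y G (qs_map (u, y, z))).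
Proof.
exact: (@measurable_Rintegral_triple_outer1 R _ _ _ _ _ _ _ _ U mu mu _ measurable_qs_map G M mG GM).
Qed.
End quicksort_recursion.

(** * Moments *)

Section truncated_moment_inequality.
Context {R : realType}.
Implicit Types (x s u a b v w L : R).

Lemma subrX_le n x s : 0 <= x -> x <= s ->
  s ^+ n.+1 - x ^+ n.+1 <= n.+1%:R * (s - x) * s ^+ n.
Proof.
move=> x0 xs; have s0 := le_trans x0 xs.
elim: n => [|n IH]; first by rewrite !expr1 expr0 mul1r mulr1.
have -> : s ^+ n.+2 - x ^+ n.+2 = s * (s ^+ n.+1 - x ^+ n.+1) + x ^+ n.+1 * (s - x).
  by rewrite !(exprS _ n.+1); ring.
have -> : n.+2%:R * (s - x) * s ^+ n.+1 =
    s * (n.+1%:R * (s - x) * s ^+ n) + s ^+ n.+1 * (s - x).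
  by rewrite -[n.+2]addn1 natrD [in LHS]exprS [s ^+ n.+1]exprS; ring.
apply: lerD; first exact: ler_wpM2l.
by apply: ler_wpM2r; [rewrite subr_ge0|rewrite lerXn2r ?nnegrE].
Qed.

Lemma minr_add_le x w L : 0 <= x -> 0 <= w -> 0 <= L ->
  Num.min (x + w + 1) L <= Num.min x L + Num.min w L + 1.
Proof. by rewrite /Order.min; do 3 case: ifPn; rewrite -?leNgt; lra. Qed.

Lemma trunc_moment_le q L u a b v : (2 <= q)%N -> 0 <= L -> 0 <= u <= 1 ->
  1 <= a -> 1 <= b -> 0 <= v -> v <= u * a + (1 - u) * b + 1 ->
  v ^+ q * Num.min v L <= u ^+ 2 * (a ^+ q * Num.min a L) +
    (1 - u) ^+ 2 * (b ^+ q * Num.min b L) +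
    (2 * q + 1)%:R * 4 ^+ q * b ^+ q * a ^+ q.
Proof.
move=> q2 L0 /andP[u0 u1] a1 b1 v0.
set x := u * a; set w := (1 - u) * b; set s := x + w + 1 => vs.
have u1' : 0 <= 1 - u by lra.
have x0 : 0 <= x by apply: mulr_ge0; lra.
have w0 : 0 <= w by apply: mulr_ge0; lra.
have xa : x <= a by rewrite /x ler_piMl; lra.
have wb : w <= b by rewrite /w ler_piMl; lra.
have s0 : 0 <= s by rewrite /s; lra.
have sxw : s <= (x + 1) * (w + 1) by have := mulr_ge0 x0 w0; rewrite /s; lra.
set D := (4 ^+ q * b ^+ q * a ^+ q).
have xwD : (x + 1) ^+ q * (w + 1) ^+ q <= D.
  rewrite /D -!exprMn; apply: lerXn2r; rewrite ?nnegrE; [apply: mulr_ge0; lra|apply: mulr_ge0; [lra|lra]|].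
  rewrite (_ : 4 * b * a = (2 * a) * (2 * b)); last by ring.
  by apply: ler_pM; lra.
have sD : s ^+ q <= D.
  apply: le_trans xwD; rewrite -exprMn; apply: lerXn2r; rewrite ?nnegrE//.
  by apply: mulr_ge0; lra.
(* The difference of powers is at most [q * (s - y)] times the power [q - 1] of [s]; then
   [s - y = y' + 1] and [s <= (y + 1) * (y' + 1)]. *)
have cross y y' : 0 <= y -> 0 <= y' -> s = y + y' + 1 ->
    (s ^+ q - y ^+ q) * y <= q%:R * ((y + 1) ^+ q * (y' + 1) ^+ q).
  move=> y0 y'0 sE; case: q {q2 D xwD sD} => [|n]; first by rewrite subrr !mul0r.
  apply: (@le_trans _ _ ((n.+1%:R * (s - y) * s ^+ n) * y)).
    by apply: ler_wpM2r => //; apply: subrX_le => //; lra.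
  have -> : s - y = y' + 1 by rewrite sE; ring.
  rewrite -!mulrA; apply: ler_wpM2l => //.
  rewrite [leRHS](_ : _ = (y' + 1) * (((y + 1) * (y' + 1)) ^+ n * (y + 1))); last first.
    by rewrite exprMn !exprS; ring.
  apply: ler_wpM2l; first lra.
  apply: ler_pM => //; [exact: exprn_ge0| |lra].
  apply: lerXn2r; rewrite ?nnegrE//; first by apply: mulr_ge0; lra.
  by rewrite sE; have := mulr_ge0 y0 y'0; lra.
have main y y' : 0 <= y -> 0 <= y' -> s = y + y' + 1 ->
    (y + 1) ^+ q * (y' + 1) ^+ q <= D ->
    s ^+ q * Num.min y L <= y ^+ q * Num.min y L + q%:R * D.
  move=> y0 y'0 sE yD.
  have ys : y ^+ q <= s ^+ q by apply: lerXn2r; rewrite ?nnegrE//; lra.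
  rewrite -lerBlDl -mulrBl; apply: (@le_trans _ _ ((s ^+ q - y ^+ q) * y)).
    by apply: ler_wpM2l; rewrite ?subr_ge0// ge_min lexx.
  by apply: le_trans (cross _ _ y0 y'0 sE) _; exact: ler_wpM2l.
have shrink c y : 0 <= c -> c <= 1 -> 1 <= y ->
    (c * y) ^+ q * Num.min (c * y) L <= c ^+ 2 * (y ^+ q * Num.min y L).
  move=> c0 c1 y1; rewrite exprMn -mulrA; apply: ler_pM.
  - exact: exprn_ge0.
  - by rewrite mulr_ge0 ?exprn_ge0 ?le_min ?L0 ?mulr_ge0; lra.
  - by apply: ler_wiXn2l.
  - apply: ler_wpM2l; first by rewrite exprn_ge0; lra.
    rewrite le_min !ge_min lexx orbT andbT; apply/orP; left.
    by rewrite ler_piMl; lra.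
have minD := minr_add_le x w L x0 w0 L0.
apply: (@le_trans _ _ (s ^+ q * Num.min s L)).
  apply: ler_pM; rewrite ?exprn_ge0 ?le_min ?v0//.
    by apply: lerXn2r; rewrite ?nnegrE.
  by rewrite !ge_min vs lexx orbT.
(* The errors from the three summands of [minD] are [q * D], [q * D] and [D], whence the factor
   [2 * q + 1]. *)
apply: (le_trans (ler_wpM2l (exprn_ge0 _ s0) minD)).
rewrite !mulrDr mulr1.
have hx := main x w x0 w0 erefl xwD.
have hw : s ^+ q * Num.min w L <= w ^+ q * Num.min w L + q%:R * D.
  by apply: (main w x) => //; [rewrite /s; ring|rewrite mulrC].
have hu := shrink u a u0 u1 a1; have hv := shrink (1 - u) b u1' ltac:(lra) b1.
rewrite -!mulrA (mulrA (4 ^+ q)) -/D natrD natrM mulrDl mul1r.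
rewrite -/x in hu; rewrite -/w in hv; lra.
Qed.
End truncated_moment_inequality.

Lemma integral_affine {R : realType} d (T : measurableType d) (P : probability T R)
    (F G : T -> R) (a b c : R) :
  P.-integrable setT (EFin \o F) -> P.-integrable setT (EFin \o G) ->
  (\int[P]_x (a * F x + b + c * G x)%:E =
   (a * (\int[P]_x F x) + b + c * (\int[P]_x G x))%:E)%E.
Proof.
move=> iF iG.
have iaF : P.-integrable setT (EFin \o (fun x => a * F x)).
  exact: (@integrableZl _ _ _ P _ measurableT a _ iF).
have icG : P.-integrable setT (EFin \o (fun x => c * G x)).
  exact: (@integrableZl _ _ _ P _ measurableT c _ iG).
have ib : P.-integrable setT (EFin \o (fun _ : T => b)) by exact: finite_measure_integrable_cst.
have iab : P.-integrable setT (EFin \o (fun x => a * F x + b)).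
  exact: (@integrableD _ _ _ P _ measurableT _ _ iaF ib).
have iabc : P.-integrable setT (EFin \o (fun x => a * F x + b + c * G x)).
  exact: (@integrableD _ _ _ P _ measurableT _ _ iab icG).
rewrite -[LHS]fineK; last exact: integrable_fin_num iabc.
congr (_%:E); rewrite -[LHS]/(\int[P]_x (a * F x + b + c * G x)).
rewrite RintegralD// RintegralD// !RintegralZl// Rintegral_cst//=.
by rewrite probability_setT mulr1.
Qed.

(** * Finite moments of all orders *)

Section quicksort_moments.
Context {R : realType} (mu : probability R R).
Hypothesis qs : is_quicksort_law mu.
Local Notation U := (uniform_prob (@ltr01 R)).
Local Notation leb := (@lebesgue_measure R).

(** The shift keeps the base at least 1, as [trunc_moment_le] requires, so that higher powers
    dominate lower ones. *)
Let V (x : R) : R := 1 + `|x|.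
Let V1 x : 1 <= V x. Proof. by rewrite /V lerDl. Qed.
Let V0 x : 0 <= V x. Proof. exact: le_trans ler01 (V1 x). Qed.
Let mV : measurable_fun setT V.
Proof. by apply: measurable_funD => //; exact: measurableT_comp. Qed.
(* Truncating only one of the [q + 1] factors keeps [f (u x) <= u ^ q f x],
   which truncating the whole power would lose. *)
Let f q L (x : R) : R := V x ^+ q * Num.min (V x) L.
Let mf q L : measurable_fun setT (f q L).
Proof.
apply: measurable_funM; first exact: measurable_funX.
exact: measurable_minr.
Qed.
Let f0 q L x : 0 <= L -> 0 <= f q L x.
Proof. by move=> L0; rewrite mulr_ge0 ?exprn_ge0// le_min V0. Qed.

(** On the unit interval [x - 1 <= x * ln x <= 0], from [ln (x^-1) <= x^-1 - 1]; this is used at [u]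
    and at [1 - u]. *)
Let qs_g_le1 (u : R) : 0 <= u <= 1 -> `|qs_g u| <= 1.
Proof.
have xlnx (x : R) : 0 <= x <= 1 -> x - 1 <= x * ln x <= 0.
  move=> /andP[]; rewrite le_eqVlt => /predU1P[<-|x0 x1]; first by rewrite mul0r; lra.
  apply/andP; split; last by apply: mulr_ge0_le0; [exact: ltW|exact: ln_le0].
  have := @le_ln1Dx R (x^-1 - 1); rewrite (addrC 1) subrK lnV ?posrE//.
  have xi : 0 < x^-1 by rewrite invr_gt0.
  have -> : -1 < x^-1 - 1 by lra.
  move=> /(_ isT) h; have := ler_wpM2l (ltW x0) h.
  by rewrite mulrBr mulfV ?gt_eqF// mulrN; lra.
move=> u01; have := xlnx _ u01; have /xlnx : 0 <= 1 - u <= 1 by lra.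
rewrite /qs_g ler_norml => h1 h2; rewrite -!mulrA; lra.
Qed.

Let V_map (u y z : R) : 0 <= u <= 1 ->
  V (qs_map (u, y, z)) <= u * V y + (1 - u) * V z + 1.
Proof.
move=> /andP[u0 u1]; have g1 := qs_g_le1 u.
rewrite /V /qs_map /=.
have h := ler_normD (u * y + (1 - u) * z) (qs_g u).
have h' := ler_normD (u * y) ((1 - u) * z).
have := g1; rewrite u0 u1 => /(_ isT) h3.
move: h'; rewrite !normrM (ger0_norm u0) (ger0_norm (_ : 0 <= 1 - u)); last lra.
by move=> h'; lra.
Qed.

Let int_square_mix (r s c : R) :
  (\int[leb]_(u in `[0%R, 1%R]) (u ^+ 2 * r + (1 - u) ^+ 2 * s + c)%:E =
   (r / 3 + s / 3 + c)%:E)%E.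
Proof.
pose F (u : R) := u ^+ 3 * (r / 3) + (1 - u) ^+ 3 * (- (s / 3)) + u * c.
have dF (u : R) : is_derive u 1 F (u ^+ 2 * r + (1 - u) ^+ 2 * s + c).
  have d1 : is_derive u 1 (fun v : R => 1 - v) (-1).
    by apply: is_derive_eq; rewrite ?/GRing.scale/=; ring.
  have d3 : is_derive u 1 (fun v : R => (1 - v) ^+ 3) ((1 - u) ^+ 2 * (-3)).
    by apply: is_derive_eq; rewrite ?/GRing.scale/=; ring.
  by rewrite /F; apply: is_derive_eq; rewrite ?/GRing.scale/=; field.
have cF (u : R) : {for u, continuous F}.
  by apply/differentiable_continuous/derivable1_diffP; have [] := dF u.
rewrite (@continuous_FTC2 _ _ F) ?ltr01//.
- by rewrite -EFinB; congr (_%:E); rewrite /F; field.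
- apply: continuous_subspaceT => u.
  have d1 : is_derive u 1 (fun v : R => 1 - v) (-1).
    by apply: is_derive_eq; rewrite ?/GRing.scale/=; ring.
  apply/differentiable_continuous/derivable1_diffP.
  have d2 : is_derive u 1 (fun v : R => (1 - v) ^+ 2) ((1 - u) * (-2)).
    by apply: is_derive_eq; rewrite ?/GRing.scale/=; ring.
  exact: ex_derive.
- split; [by move=> u _; have [] := dF u| |].
  + by apply: cvg_at_right_filter; exact: cF.
  + by apply: cvg_at_left_filter; exact: cF.
- by move=> u _; rewrite derive1E; have [] := dF u.
Qed.

Section step.
Variable q : nat.
Hypotheses (q2 : (2 <= q)%N) (iq : mu.-integrable setT (fun x => (V x ^+ q)%:E)).
Let K : R := (2 * q + 1)%:R * 4 ^+ q.
Let M : R := \int[mu]_x (V x ^+ q).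


Let int_f L : 0 <= L -> mu.-integrable setT (EFin \o f q L).
Proof.
move=> L0; apply: (@le_integrable _ _ _ _ _ _ _ (fun x => (L * V x ^+ q)%:E)) => //.
- exact/measurable_EFinP.
- move=> x _; rewrite lee_fin !ger0_norm ?f0 ?mulr_ge0 ?exprn_ge0//.
  rewrite [leRHS]mulrC; apply: ler_wpM2l; first by rewrite exprn_ge0.
  by rewrite ge_min lexx orbT.
- exact: (@integrableZl _ _ _ mu _ measurableT L _ iq).
Qed.

(** Truncation makes [r] finite, so [r <= r / 3 + r / 3 + K * M * M] can be solved for [r]; the
    thirds are the means of [u ^+ 2] and [(1 - u) ^+ 2]. The bound does not depend on [L]. *)
Lemma truncated_moment_le L : 0 <= L -> \int[mu]_x f q L x <= 3 * (K * M * M).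
Proof.
move=> L0; set r := \int[mu]_x f q L x.
have rE : (\int[mu]_x (f q L x)%:E = r%:E)%E.
  by rewrite /r /Rintegral fineK//; exact: integrable_fin_num (int_f L L0).
suff : r <= r / 3 + r / 3 + K * M * M by lra.
rewrite -lee_fin -[leLHS]rE.
have mfx : measurable_fun setT (EFin \o f q L) by exact/measurable_EFinP.
have f0x x : (0 <= (EFin \o f q L) x)%E by rewrite lee_fin f0.
rewrite (ge0_quicksort_integral _ qs (EFin \o f q L) mfx f0x).
(* The right side is rewritten as an integral over [z], then [u], then [y], so monotonicity reduces
   the claim to [trunc_moment_le]. *)
have -> : (r / 3 + r / 3 + K * M * M)%:E =
    (\int[mu]_z (3^-1 * f q L z + r / 3 + K * M * (V z ^+ q))%:E)%E.
  by rewrite integral_affine// ?int_f//; congr (_%:E); rewrite -/M -/r; ring.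
have mfq : measurable_fun setT (EFin \o f q L \o @qs_map R).
  exact: measurableT_comp mfx measurable_qs_map.
have mfz z : measurable_fun setT (fun u => \int[mu]_y (f q L (qs_map (u, y, z)))%:E)%E.
  apply: (measurable_fun_fubini_tonelli_F (fun v => (f q L (qs_map (v, z)))%:E)).
    exact: measurableT_comp mfq (pair2_measurable z).
  by move=> v; rewrite lee_fin f0.
have f0e z u : (0 <= \int[mu]_y (f q L (qs_map (u, y, z)))%:E)%E.
  by apply: integral_ge0 => y _; rewrite lee_fin f0.
apply: ge0_le_integral => //.
- by move=> z _; apply: integral_ge0 => u _; exact: f0e.
- exact: measurable_ge0_quicksort_integral mfx f0x.
- apply/measurable_EFinP; apply: measurable_funD; last first.
    by apply: measurable_funM => //; exact: measurable_funX.
  by apply: measurable_funD => //; exact: measurable_funM.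
move=> z _; rewrite (integral_uniform01 _ (mfz z) (f0e z)).
have -> : (3^-1 * f q L z + r / 3 + K * M * V z ^+ q)%:E =
    (\int[leb]_(u in `[0%R, 1%R])
       (u ^+ 2 * r + (1 - u) ^+ 2 * f q L z + K * M * V z ^+ q)%:E)%E.
  by rewrite int_square_mix; congr (_%:E); ring.
apply: ge0_le_integral => //.
- by apply: measurable_funTS; exact: mfz.
- apply/measurable_EFinP/measurable_funTS; apply: measurable_funD => //.
  apply: measurable_funD; apply: measurable_funM => //.
  by apply: measurable_funX; exact: measurable_funB.
move=> u /=; rewrite in_itv/= => u01.
have -> : (u ^+ 2 * r + (1 - u) ^+ 2 * f q L z + K * M * V z ^+ q)%:E =
   (\int[mu]_y (u ^+ 2 * f q L y + (1 - u) ^+ 2 * f q L z + (K * V z ^+ q) * V y ^+ q)%:E)%E.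
  by rewrite integral_affine ?int_f//; congr (_%:E); rewrite -/M -/r; ring.
apply: ge0_le_integral => //.
- by move=> y _; rewrite lee_fin f0.
- exact: measurableT_comp mfq (measurableT_comp (pair2_measurable z) (pair1_measurable u)).
- apply/measurable_EFinP; apply: measurable_funD; last first.
    by apply: measurable_funM => //; exact: measurable_funX.
  by apply: measurable_funD => //; exact: measurable_funM.
move=> y _; rewrite lee_fin; apply: trunc_moment_le => //.
exact: V_map.
Qed.

Let cvg_trunc x : (EFin \o (fun n : nat => f q n%:R x)) @ \oo --> (V x ^+ q.+1)%:E.
Proof.
apply: cvg_near_cst; near=> n.
have Vn : V x <= n%:R by near: n; exact: nbhs_infty_ger.
by rewrite /= /f min_l// exprSr.
Unshelve. all: by end_near. Qed.

(** The truncated moments increase to the full one as [L] runs through the naturals, and monotone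
    convergence preserves their uniform bound. *)
Lemma moment_succ : mu.-integrable setT (fun x => (V x ^+ q.+1)%:E).
Proof.
apply/integrableP; split.
  by apply/measurable_EFinP; exact: measurable_funX.
have bnd (n : nat) : (\int[mu]_x (f q n%:R x)%:E <= (3 * (K * M * M))%:E)%E.
  rewrite -[leLHS]fineK; last exact: (integrable_fin_num measurableT (int_f _ (ler0n _ n))).
  by rewrite lee_fin; exact: (truncated_moment_le _ (ler0n _ n)).
have -> : (\int[mu]_x `|(V x ^+ q.+1)%:E| = limn (fun n => \int[mu]_x (f q n%:R x)%:E))%E.
  rewrite -monotone_convergence//.
  - apply: eq_integral => x _.
    by rewrite (cvg_lim _ (cvg_trunc x))// gee0_abs// lee_fin exprn_ge0.
  - by move=> n; exact/measurable_EFinP.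
  - by move=> n x _; rewrite lee_fin f0.
  - move=> x _ m n mn; rewrite lee_fin; apply: ler_wpM2l; first by rewrite exprn_ge0.
    by rewrite le_min !ge_min lexx ler_nat mn orbT.
apply: (@le_lt_trans _ _ (3 * (K * M * M))%:E); last exact: ltry.
apply: lime_le; last exact: nearW.
apply: ereal_nondecreasing_is_cvgn => m n mn.
apply: ge0_le_integral => //.
- by move=> x _; rewrite lee_fin f0.
- exact/measurable_EFinP.
- exact/measurable_EFinP.
- move=> x _; rewrite lee_fin; apply: ler_wpM2l; first by rewrite exprn_ge0.
  by rewrite le_min !ge_min lexx ler_nat mn orbT.
Qed.
End step.

Lemma quicksort_moments (k : nat) : mu.-integrable setT (fun x => (`|x| ^+ k)%:E).
Proof.
(* The finite variance starts the induction, since twice [1 + x ^+ 2] dominates [V x ^+ 2]. *)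
have i2 : mu.-integrable setT (fun x => (V x ^+ 2)%:E).
  case: qs => i2 _ _.
  apply: (@le_integrable _ _ _ _ _ _ _ (fun x : R => (2 + 2 * x ^+ 2 : R)%:E)) => //.
  - by apply/measurable_EFinP; exact: measurable_funX.
  - move=> x _; rewrite lee_fin !ger0_norm ?exprn_ge0//; last first.
      by rewrite addr_ge0// mulr_ge0// sqr_ge0.
    rewrite /V -(real_normK (num_real x)) -subr_ge0.
    by rewrite (_ : _ - _ = (1 - `|x|) ^+ 2) ?sqr_ge0//; ring.
  - apply: (@integrableD _ _ _ mu _ measurableT (fun=> (2 : R)%:E) (fun x : R => (2 * x ^+ 2 : R)%:E)).
      exact: finite_measure_integrable_cst.
    exact: (@integrableZl _ _ _ mu _ measurableT 2 _ i2).
have im (m : nat) : mu.-integrable setT (fun x => (V x ^+ m.+2)%:E).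
  by elim: m => // m; exact: moment_succ.
(* The induction started at 2, so [im k] concerns the power [k.+2], which dominates the power [k]
   because [V] is at least 1. *)
apply: (@le_integrable _ _ _ _ _ measurableT _ _ _ _ (im k)) => //.
  by apply/measurable_EFinP/measurable_funX.
move=> x _; rewrite lee_fin normrX normr_id [leRHS]ger0_norm ?exprn_ge0 //.
apply: (@le_trans _ _ (V x ^+ k)).
  by apply: lerXn2r; rewrite ?nnegrE ?V0 // /V lerDr.
by apply: ler_weXn2l; [exact: V1|rewrite !leqW].
Qed.
End quicksort_moments.

(** * Decay of the characteristic function and its derivatives *)

Section trigonometric_moments.
Context {R : realType} (mu : probability R R).
Hypothesis qs : is_quicksort_law mu.
Local Notation U := (uniform_prob (@ltr01 R)).
Local Notation leb := (@lebesgue_measure R).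

(* The real part of [exp (i th) E (Y^k exp (i t Y))]: real parts, imaginary
   parts and derivatives of the characteristic function are all phase shifts. *)
Definition tmoment (k : nat) (th t : R) : R :=
  \int[mu]_x (x ^+ k * cos (t * x + th)).

Let absm (k : nat) : R := \int[mu]_x (`|x| ^+ k).

Let mcos (t th : R) : measurable_fun setT (fun x : R => cos (t * x + th)).
Proof.
apply: measurableT_comp; first exact: continuous_measurable_fun (@continuous_cos R).
by apply: measurable_funD => //; exact: measurable_funM.
Qed.

Let cos_le (x : R) : `|cos x| <= 1.
Proof. by rewrite ler_norml cos_geN1 cos_le1. Qed.

Let int_tmoment k th t :
  mu.-integrable setT (EFin \o (fun x : R => x ^+ k * cos (t * x + th))).
Proof.
apply: (@le_integrable _ _ _ _ _ measurableT _ _ _ _ (quicksort_moments mu qs k)).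
  by apply/measurable_EFinP/measurable_funM => //; exact: measurable_funX.
move=> x _; rewrite lee_fin normrM normrX [leRHS]ger0_norm ?exprn_ge0//.
by rewrite ler_piMr ?exprn_ge0.
Qed.

Lemma tmoment_le k th t : `|tmoment k th t| <= absm k.
Proof.
apply: (le_trans (le_normr_Rintegral measurableT (int_tmoment k th t))).
apply: le_Rintegral => //.
- exact: (integrable_norm (int_tmoment k th t)).
- exact: quicksort_moments.
- by move=> x _; rewrite normrM normrX ler_piMr ?exprn_ge0.
Qed.

(** Differentiation under the integral, dominated by the absolute moment of order [k.+1]; as
    [- sin a = cos (a + pi / 2)], a derivative is again a [tmoment]. *)
Lemma is_derive_tmoment k th (t : R) :
  is_derive t 1 (tmoment k th) (tmoment k.+1 (th + pi / 2) t).
Proof.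
have dcos (x s : R) : is_derive s 1 (fun s => x ^+ k * cos (s * x + th))
    (x ^+ k.+1 * cos (s * x + (th + pi / 2))).
  have dA : is_derive s 1 (fun s : R => s * x + th) x.
    by apply: is_derive_eq; rewrite ?/GRing.scale/=; ring.
  have dC := @is_derive1_comp _ (@cos R) _ s _ _ (is_derive_cos _) dA.
  apply: is_derive_eq; rewrite addrA cosDpihalf /GRing.scale/= exprSr; ring.
have Ia : `]t - 1, t + 1[%classic t by rewrite /= in_itv/=; apply/andP; split; lra.
have D1 x s : partial1of2 (fun s x => x ^+ k * cos (s * x + th)) s x =
    x ^+ k.+1 * cos (s * x + (th + pi / 2)).
  by rewrite partial1of2E; have [] := dcos x s.
have H1 (s : R) : `]t - 1, t + 1[%classic s -> mu.-integrable setT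
    (EFin \o (fun x : R => x ^+ k * cos (s * x + th))) by move=> _; exact: int_tmoment.
have H2 (s x : R) : `]t - 1, t + 1[%classic s -> setT x ->
    derivable ((fun s x => x ^+ k * cos (s * x + th)) ^~ x) s 1.
  by move=> _ _; have [] := dcos x s.
have H3 (x : R) : 0 <= `|x| ^+ k.+1 by exact: exprn_ge0.
have H4 : mu.-integrable setT (EFin \o (fun x : R => `|x| ^+ k.+1)).
  exact: quicksort_moments.
have H5 (s x : R) : `]t - 1, t + 1[%classic s -> setT x ->
    `|partial1of2 (fun s x => x ^+ k * cos (s * x + th)) s x| <= `|x| ^+ k.+1.
  by move=> _ _; rewrite D1 normrM normrX ler_piMr ?exprn_ge0.
constructor.
  exact: (derivable_under_integral measurableT Ia H1 H2 H3 H4 H5).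
rewrite -derive1E.
rewrite (differentiation_under_integral measurableT Ia H1 H2 H3 H4 H5).
by apply: eq_Rintegral => x _; rewrite D1.
Qed.

Lemma derive1n_tmoment0 k th :
  derive1n k (tmoment 0 th) = tmoment k (th + k%:R * (pi / 2)).
Proof.
elim: k => [|k IH]; first by rewrite mul0r addr0.
rewrite derive1nS IH; apply/funext => t; rewrite derive1E.
have [_ ->] := is_derive_tmoment k (th + k%:R * (pi / 2)) t.
by congr (tmoment _ _ _); rewrite -natr1; ring.
Qed.

Lemma charfun_reE : charfun_re mu = tmoment 0 0.
Proof.
apply/funext => t; rewrite /charfun_re /tmoment /Rintegral; congr fine.
by apply: eq_integral => x _; rewrite expr0 mul1r addr0.
Qed.

Lemma charfun_imE : charfun_im mu = tmoment 0 (- (pi / 2)).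
Proof.
apply/funext => t; rewrite /charfun_im /tmoment /Rintegral; congr fine.
by apply: eq_integral => x _; rewrite expr0 mul1r cosBpihalf.
Qed.

(** The free phase absorbs the reflection, which reduces negative [t] to positive [t]. *)
Lemma tmomentN k th t : tmoment k th (- t) = tmoment k (- th) t.
Proof.
by apply: eq_Rintegral => x _; rewrite -cosN opprD mulNr opprK.
Qed.

Lemma tmoment0_le1 th t : `|tmoment 0 th t| <= 1.
Proof.
apply: le_normr_prob_Rintegral.
  by under eq_fun do rewrite expr0 mul1r; exact: mcos.
by move=> x; rewrite expr0 mul1r cos_le.
Qed.

Lemma tmoment0E th t : tmoment 0 th t = \int[mu]_x cos (t * x + th).
Proof. by apply: eq_Rintegral => x _; rewrite expr0 mul1r. Qed.

Lemma tmoment0_vdC th t : 0 < t -> `|tmoment 0 th t| <= 5 * t `^ (- (1 / 2)).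
Proof.
move=> t0; rewrite tmoment0E.
apply: (quicksort_Rintegral_le mu qs (fun x => cos (t * x + th)) 1) => // z y.
rewrite (Rintegral_uniform01 _ 1)//; first exact: osc_integral01.
apply: measurableT_comp; first exact: continuous_measurable_fun (@continuous_cos R).
apply: measurable_funD => //; apply: measurable_funM => //.
exact: measurable_qs_phase.
Qed.

End trigonometric_moments.

(** The difference quotient of [f] over a step [h] is a value of [f1] at some point within [h] of
    [t], and [f1] varies by at most [M * h] in between. *)
Lemma landau_step {R : realType} (f f1 f2 : R -> R) (M t h : R) : 0 < h ->
  (forall s : R, is_derive s 1 f (f1 s)) -> (forall s : R, is_derive s 1 f1 (f2 s)) ->
  (forall s, `|f2 s| <= M) ->
  `|f1 t| * h <= `|f (t + h)| + `|f t| + M * h * h.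
Proof.
move=> h0 D1 D2 fM; have th : t < t + h by rewrite ltrDl.
have C1 : {within `[t, t + h], continuous f}.
  by apply: derivable_within_continuous => s _; have [] := D1 s.
have [x /[!in_itv]/= /andP[tx xh] Ex] := MVT th (fun s _ => D1 s) C1.
have C2 : {within `[t, x], continuous f1}.
  by apply: derivable_within_continuous => s _; have [] := D2 s.
have [y _ Ey] := MVT tx (fun s _ => D2 s) C2.
have bx : `|f1 x| * h <= `|f (t + h)| + `|f t|.
  rewrite -{1}(gtr0_norm h0) -normrM.
  have -> : f1 x * h = f (t + h) - f t by rewrite Ex; ring.
  exact: ler_normB.
have bxt : `|f1 x - f1 t| <= M * h.
  by rewrite Ey normrM; apply: ler_pM => //; rewrite gtr0_norm; lra.
apply: (@le_trans _ _ ((`|f1 x| + M * h) * h)); last by rewrite mulrDl lerD2r.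
rewrite ler_pM2r// -[f1 t](subKr (f1 x)).
by apply: (le_trans (ler_normB _ _)); rewrite lerD2l.
Qed.

(** * The bootstrap, and the passage to derivatives *)

Section decay.
Context {R : realType} (mu : probability R R).
Hypothesis qs : is_quicksort_law mu.
Local Notation U := (uniform_prob (@ltr01 R)).
Local Notation leb := (@lebesgue_measure R).
Local Notation F := (tmoment mu).

(** Reduces every phase to the real and imaginary parts, which separates the two copies in the
    recursion. *)
Lemma tmoment0_angle th s : F 0 th s = cos th * F 0 0 s - sin th * F 0 (- (pi / 2)) s.
Proof.
have i0 a : mu.-integrable setT (EFin \o (fun x => cos (s * x + a))).
  apply: (bounded_prob_integrable mu _ 1); last first.
    by move=> x; rewrite ler_norml cos_geN1 cos_le1.
  apply: measurableT_comp; first exact: continuous_measurable_fun (@continuous_cos R).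
  by apply: measurable_funD => //; exact: measurable_funM.
rewrite !tmoment0E -!RintegralZl// -RintegralB//.
- by apply: eq_Rintegral => x _; rewrite cosBpihalf addr0 cosD; ring.
- exact: (@integrableZl _ _ _ mu _ measurableT (cos th) _ (i0 0)).
- exact: (@integrableZl _ _ _ mu _ measurableT (sin th) _ (i0 (- (pi / 2)))).
Qed.

Let I th t u : R := \int[mu]_z \int[mu]_y cos (t * qs_map (u, y, z) + th).

(** The real part of the product of [exp (i b) phi (t (1 - u))] and [phi (t u)]; its two terms
    account for the factor 2 in [I_le]. *)
Let IE th t u : let b := t * qs_g u + th in
  I th t u = F 0 b (t * (1 - u)) * F 0 0 (t * u)
    - F 0 (b - pi / 2) (t * (1 - u)) * F 0 (- (pi / 2)) (t * u).
Proof.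
move=> b; have i0 a : mu.-integrable setT (EFin \o (fun x => cos (t * (1 - u) * x + a))).
  apply: (bounded_prob_integrable mu _ 1); last first.
    by move=> x; rewrite ler_norml cos_geN1 cos_le1.
  apply: measurableT_comp; first exact: continuous_measurable_fun (@continuous_cos R).
  by apply: measurable_funD => //; exact: measurable_funM.
rewrite (tmoment0E _ b) (tmoment0E _ (b - pi / 2)) -!RintegralZr// -RintegralB//.
- apply: eq_Rintegral => z _.
  transitivity (F 0 (t * (1 - u) * z + b) (t * u)).
    rewrite tmoment0E; apply: eq_Rintegral => y _; congr cos.
    by rewrite /qs_map/= /b; ring.
  by rewrite tmoment0_angle (addrA _ b) cosBpihalf.
- exact: (@integrableZr _ _ _ mu _ measurableT _ _ (i0 b)).
- exact: (@integrableZr _ _ _ mu _ measurableT _ _ (i0 (b - pi / 2))).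
Qed.

Let I_le A B th t u : 0 <= A -> 0 <= B ->
  (forall a, `|F 0 a (t * (1 - u))| <= A) -> (forall a, `|F 0 a (t * u)| <= B) ->
  `|I th t u| <= 2 * A * B.
Proof.
move=> A0 B0 FA FB; rewrite IE; apply: (le_trans (ler_normB _ _)).
rewrite !normrM -mulrA mulr2n [leRHS]mulrDl mul1r.
by apply: lerD; apply: ler_pM.
Qed.

Let mI th t : measurable_fun setT (I th t).
Proof.
apply: (measurable_quicksort_outer1 mu (fun x => cos (t * x + th)) 1).
  apply: measurableT_comp; first exact: continuous_measurable_fun (@continuous_cos R).
  by apply: measurable_funD => //; exact: measurable_funM.
by move=> x; rewrite ler_norml cos_geN1 cos_le1.
Qed.

Let I_le2 th t u : `|I th t u| <= 2.
Proof.
have := I_le 1 1 th t u ler01 ler01; rewrite !mulr1; apply => a; exact: tmoment0_le1.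
Qed.

Let F0E th t : F 0 th t = \int[leb]_(u in `[0, 1]) I th t u.
Proof.
rewrite -(Rintegral_uniform01 _ 2 (mI th t) (I_le2 th t)) tmoment0E.
rewrite (quicksort_Rintegral_outer1 mu qs (fun x => cos (t * x + th)) 1)//.
  apply: measurableT_comp; first exact: continuous_measurable_fun (@continuous_cos R).
  by apply: measurable_funD => //; exact: measurable_funM.
by move=> x; rewrite ler_norml cos_geN1 cos_le1.
Qed.

(** One constant serves all phases, because both the recursion and differentiation shift [th]. *)
Definition decays (k : nat) (p : R) : Prop :=
  exists c : R, forall th t, 0 < t -> t `^ p * `|F k th t| <= c.

Lemma decays_bootstrap p : 0 <= p -> decays 0 p -> decays 0 (p + 1 / 3).
Proof.
move=> p0 [c hc].
have c0 : 0 <= c by apply: le_trans (hc 0 1 ltr01); rewrite mulr_ge0 ?powR_ge0.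
(* The summand 1 covers [t <= 1]; the other is computed in [Q]. *)
exists (1 + 22 * c * 2 `^ p) => th t t0.
have K0 : 0 <= 22 * c * 2 `^ p by rewrite !mulr_ge0 ?powR_ge0.
have [t1|t1] := leP t 1.
  rewrite -[leLHS]mulr1 -mulrA; apply: (@le_trans _ _ 1); last by rewrite lerDl.
  rewrite mulr1 -[leRHS]mulr1; apply: ler_pM; rewrite ?powR_ge0//; last exact: tmoment0_le1.
  rewrite -[leRHS](powRr0 t); apply: ger_powR; [by rewrite t0|lra].
apply: (@le_trans _ _ (22 * c * 2 `^ p)); last by rewrite lerDr.
(* The discarded ends have total length [r], while the oscillation bound at arguments above
   [t * (r / 2)] has the order of [t * r] to the power -1/2. This [r] makes both of order [r]. *)
set r := t `^ (- (1 / 3)); have r0 : 0 < r by exact: powR_gt0.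
have r1 : r <= 1 by rewrite -[leRHS](powRr0 t); apply: ler_powR; [exact: ltW|lra].
set q := (t / 2) `^ (- p); have q0 : 0 <= q by exact: powR_ge0.
have t20 : 0 < t / 2 by rewrite divr_gt0.
have far s a : t / 2 <= s -> `|F 0 a s| <= c * q.
  move=> ts; have s0 : 0 < s by exact: lt_le_trans ts.
  rewrite /q powRN ler_pdivlMr ?powR_gt0// mulrC.
  apply: le_trans (hc a s s0); apply: ler_wpM2r => //.
  by apply: ge0_ler_powR; rewrite ?nnegrE// ltW.
have near s a : t * (r / 2) <= s -> `|F 0 a s| <= 10 * r.
  move=> ts; have s0 : 0 < s by apply: lt_le_trans ts; rewrite !mulr_gt0// invr_gt0.
  apply: (le_trans (tmoment0_vdC mu qs a s s0)).
  suff : s `^ (- (1 / 2)) <= 2 * r by lra.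
  have tr : t = (r ^+ 3)^-1.
    have -> : r ^+ 3 = t^-1; last by rewrite invrK.
    rewrite -powR_mulrn ?(ltW r0)// /r -powRrM -[RHS]powR_inv1 ?(ltW t0)//.
    by congr (_ `^ _); field.
  have s_ge : (2 * r) `^ (- 2%:R) <= s.
    apply: le_trans ts; rewrite powRN powR_mulrn; last by rewrite mulr_ge0// ltW.
    rewrite tr (_ : _ * (r / 2) = (2 * r ^+ 2)^-1); last by field; lra.
    have rr : 0 < r ^+ 2 by exact: exprn_gt0.
    by rewrite exprMn lef_pV2 ?posrE ?mulr_gt0 ?exprn_gt0//; lra.
  have -> : 2 * r = ((2 * r) `^ (- 2%:R)) `^ (- (1 / 2)).
    rewrite -powRrM (_ : - 2%:R * - (1 / 2) = 1); last by field.
    by rewrite powRr1// mulr_ge0// ltW.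
  rewrite 2!(powRN _ (1 / 2)) lef_pV2 ?posrE ?powR_gt0//; last by rewrite mulr_gt0.
  apply: ge0_ler_powR => //.
  - by rewrite nnegrE powR_ge0.
  - by rewrite nnegrE ltW.
have Q : t `^ (p + 1 / 3) * (11 * r * (2 * (c * q))) = 22 * c * 2 `^ p.
  have A0 : t `^ p != 0 by rewrite gt_eqF// powR_gt0.
  have B0 : t `^ (1 / 3) != 0 by rewrite gt_eqF// powR_gt0.
  have -> : q = 2 `^ p / t `^ p.
    have C0 : (t / 2) `^ p != 0 by rewrite gt_eqF// powR_gt0.
    have -> : t `^ p = 2 `^ p * (t / 2) `^ p.
      by rewrite -powRM ?ltW//; congr (_ `^ _); field.
    have D0 : (2 : R) `^ p != 0 by rewrite gt_eqF// powR_gt0.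
    by rewrite /q powRN; field; apply/andP.
  rewrite powRD; last by rewrite (gt_eqF t0) implybT.
  by rewrite /r powRN; field; apply/andP.
rewrite -Q; apply: ler_wpM2l; first exact: powR_ge0.
set k := 2 * (c * q).
have cq0 : 0 <= c * q by exact: mulr_ge0.
(* One of the two arguments is at least [t / 2]; the other factor is bounded by 1. *)
have side u : 0 <= u <= 1 -> `|I th t u| <= k.
  move=> /andP[u0 u1]; have [uh|uh] := leP u (1 / 2).
    rewrite -[k]mulr1; apply: I_le => // a; last exact: tmoment0_le1.
    by apply: far; apply: ler_wpM2l; lra.
  rewrite (_ : k = 2 * 1 * (c * q)); last by rewrite /k mulr1.
  apply: I_le => // a; first exact: tmoment0_le1.
  by apply: far; apply: ler_wpM2l; lra.
have r2 : 0 <= 10 * r by rewrite mulr_ge0// ltW.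
(* Here the smaller argument is at least [t * (r / 2)], so the other factor gains [10 * r]. *)
have middle u : r / 2 <= u <= 1 - r / 2 -> `|I th t u| <= k * (10 * r).
  move=> /andP[u0 u1]; have [uh|uh] := leP u (1 / 2).
    apply: I_le => // a; first by apply: far; apply: ler_wpM2l; lra.
    by apply: near; apply: ler_wpM2l; lra.
  rewrite (_ : k * (10 * r) = 2 * (10 * r) * (c * q)); last by rewrite /k; ring.
  apply: I_le => // a; last by apply: far; apply: ler_wpM2l; lra.
  by apply: near; apply: ler_wpM2l; lra.
have split := Rintegral_segment_split (I th t) (mI th t) 2.
have bnd := Rintegral_segment_le (I th t) (mI th t) 2.
rewrite F0E (split 0 (r / 2) 1 (I_le2 th t)); [|lra..].
rewrite (split (r / 2) (1 - r / 2) 1 (I_le2 th t)); [|lra..].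
have b1 : `|\int[leb]_(u in `[0, (r / 2)]) I th t u| <= k * (r / 2 - 0).
  by apply: bnd => //; [lra|move=> u u01; apply: side; lra].
have b2 : `|\int[leb]_(u in `[(1 - r / 2), 1]) I th t u| <= k * (1 - (1 - r / 2)).
  by apply: bnd => //; [lra|move=> u u01; apply: side; lra].
have b3 : `|\int[leb]_(u in `[(r / 2), (1 - r / 2)]) I th t u| <=
    k * (10 * r) * (1 - r / 2 - r / 2).
  by apply: bnd => //; lra.
have b3' : k * (10 * r) * (1 - r / 2 - r / 2) <= k * (10 * r).
  by rewrite ler_piMr ?mulr_ge0//; lra.
apply: (le_trans (ler_normD _ _)).
apply: (le_trans (lerD (lexx _) (ler_normD _ _))).
apply: (le_trans (lerD b1 (lerD (le_trans b3 b3') b2))).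
(* The ends contribute [k * r] together and the middle [10 * k * r], which is the factor 11 in
   [Q]. *)
by rewrite le_eqVlt; apply/orP; left; apply/eqP; field.
Qed.

(** Enough bootstraps from the trivial order 0 pass [p]. Lowering the exponent back to [p] is
    harmless for [t > 1], and for [t <= 1] both factors are at most 1. *)
Lemma decays_0 p : 0 <= p -> decays 0 p.
Proof.
move=> p0; have [n pn] : exists n : nat, p <= n%:R / 3.
  exists (Num.truncn (p * 3)).+1.
  by rewrite ler_pdivlMr// ltW// truncnS_gt.
have : decays 0 (n%:R / 3).
  elim: n {pn} => [|n IH].
    by rewrite mul0r; exists 1 => th t t0; rewrite powRr0 mul1r tmoment0_le1.
  rewrite (_ : n.+1%:R / 3 = n%:R / 3 + 1 / 3); last by rewrite -natr1; field.
  by apply: decays_bootstrap => //; exact: divr_ge0.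
move=> [c hc]; exists (1 + c) => th t t0.
have c0 : 0 <= c by apply: le_trans (hc 0 1 ltr01); rewrite mulr_ge0 ?powR_ge0.
have [t1|t1] := leP t 1.
  apply: (@le_trans _ _ (1 * 1)); last by rewrite mulr1 lerDl.
  apply: ler_pM; rewrite ?powR_ge0//; last exact: tmoment0_le1.
  rewrite -[leRHS](powRr0 t); apply: ger_powR => //; exact/andP.
apply: (@le_trans _ _ c); last by rewrite lerDr.
apply: le_trans (hc th t t0); apply: ler_wpM2r => //.
by apply: ler_powR => //; exact: ltW.
Qed.

Lemma decays_succ k : (forall p, 0 <= p -> decays k p) ->
  forall p, 0 <= p -> decays k.+1 p.
Proof.
move=> IH p p0; have [c hc] := IH (2 * p) (mulr_ge0 (ler0n _ 2) p0).
set M : R := \int[mu]_x (`|x| ^+ k.+2).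
exists (2 * c + M) => th t t0.
(* With this step the values of the [k]-th derivative, of order [2 * p], and the Landau error are
   all of size [h * h]; dividing by it leaves [2 * c + M]. *)
set h := t `^ (- p); have h0 : 0 < h by exact: powR_gt0.
pose a := th - pi / 2; have aE : a + pi / 2 = th by rewrite subrK.
have b s : t <= s -> `|F k a s| <= c * (h * h).
  move=> ts; have s0 := lt_le_trans t0 ts.
  have -> : h * h = (t `^ (2 * p))^-1.
    rewrite -powRN /h -powRD; last by rewrite (gt_eqF t0) implybT.
    by congr (_ `^ _); ring.
  rewrite ler_pdivlMr ?powR_gt0// mulrC; apply: le_trans (hc a s s0).
  apply: ler_wpM2r => //; apply: ge0_ler_powR; rewrite ?nnegrE ?(ltW t0) ?(ltW s0)//.
  exact: mulr_ge0.
have -> : t `^ p * `|F k.+1 th t| = `|F k.+1 th t| / h.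
  by rewrite /h powRN invrK mulrC.
rewrite ler_pdivrMr// -(ler_pM2r h0).
apply: (@le_trans _ _ (`|F k a (t + h)| + `|F k a t| + M * h * h)).
  apply: (landau_step (F k a) (F k.+1 th) (F k.+2 (th + pi / 2))) => //.
  - by move=> s; have := is_derive_tmoment mu qs k a s; rewrite aE.
  - by move=> s; exact: is_derive_tmoment.
  - by move=> s; exact: tmoment_le.
have := b t (lexx t); have := b (t + h); rewrite lerDl (ltW h0) => /(_ isT).
rewrite mulrDl mulrDl !mulrA; lra.
Qed.

Lemma decays_all k p : 0 <= p -> decays k p.
Proof. by elim: k p => [|k IH] p p0; [exact: decays_0|exact: decays_succ]. Qed.

Lemma tmoment_decay k th p : 0 <= p ->
  exists c : R, forall t, `|t| `^ p * `|F k th t| <= c.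
Proof.
move=> p0; have [c hc] := decays_all k p p0.
set M : R := \int[mu]_x (`|x| ^+ k).
have c0 : 0 <= c by apply: le_trans (hc 0 1 ltr01); rewrite mulr_ge0 ?powR_ge0.
have M0 : 0 <= M by apply: le_trans (tmoment_le mu qs k 0 0).
exists (c + M) => t; have [t0|t0|->] := ltgtP t 0.
- rewrite -[t in F _ _ t]opprK tmomentN ler0_norm ?(ltW t0)//.
  by apply: (@le_trans _ _ c); [apply: hc; rewrite oppr_gt0|rewrite lerDl].
- rewrite gtr0_norm//.
  by apply: (@le_trans _ _ c); [exact: hc|rewrite lerDl].
- apply: (@le_trans _ _ (1 * M)); last by rewrite mul1r lerDr.
  apply: ler_pM; rewrite ?powR_ge0//; last exact: tmoment_le.
  (* The power of 0 is 1 for [p = 0] and 0 otherwise, hence at most 1. *)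
  rewrite normr0; have [->|pn0] := eqVneq p 0; first by rewrite powRr0.
  by rewrite powR0.
Qed.
End decay.

(* phi^(k) = (charfun_re mu)^`(k) + i (charfun_im mu)^`(k);
   |phi^(k)(t)| is the complex modulus of that. *)
Theorem theorem2p9 (R : realType) (mu : probability R R) :
  is_quicksort_law mu ->
  forall k : nat,
    (forall t : R, derivable (derive1n k (charfun_re mu)) t 1 /\
                   derivable (derive1n k (charfun_im mu)) t 1) /\
    (forall p : R, 0 <= p -> exists c : R, forall t : R,
       `|t| `^ p * Num.sqrt ((derive1n k (charfun_re mu) t) ^+ 2
                             + (derive1n k (charfun_im mu) t) ^+ 2) <= c).
Proof.
move=> qs k; rewrite charfun_reE charfun_imE !(derive1n_tmoment0 mu qs); split.
  by move=> t; split; [have [] := is_derive_tmoment mu qs k (0 + k%:R * (pi / 2)) t|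
    have [] := is_derive_tmoment mu qs k (- (pi / 2) + k%:R * (pi / 2)) t].
move=> p p0.
have [c hc] := tmoment_decay mu qs k (0 + k%:R * (pi / 2)) p p0.
have [d hd] := tmoment_decay mu qs k (- (pi / 2) + k%:R * (pi / 2)) p p0.
exists (c + d) => t; apply: le_trans (lerD (hc t) (hd t)).
rewrite -mulrDr; apply: ler_wpM2l; first exact: powR_ge0.
set x := tmoment _ _ _ _; set y := tmoment _ _ _ _.
(* The modulus is at most the sum of absolute values, whose square has an extra nonnegative cross
   term. *)
rewrite -[leRHS]ger0_norm ?addr_ge0// -sqrtr_sqr; apply: ler_wsqrtr.
rewrite sqrrD !real_normK ?num_real// lerD2r lerDl.
by rewrite mulrn_wge0// mulr_ge0.
Qed.
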